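(* Let $w\in\mathbb R^n$ be an $L$-generic direction, let $\Lambda\in\mathfrak L_\beta$, and fix $\lambda\in\Lambda$. Let $\varphi=\sum_{\gamma\in\Lambda}x^\gamma r_\gamma(\log x)\in\mathscr F^{\log}_{\widetilde\Lambda}[\Lambda]$ be a formal logarithmic expression, with normalized coefficients $c^{(\lambda)}_\gamma=(\widetilde d_{\gamma\leftarrow\lambda}\bullet)^{-1}(\widetilde d_{\lambda\leftarrow\gamma}\bullet r_\gamma)$ for $\gamma\in\Lambda$. Then the following conditions are equivalent. (1) $\varphi\in\mathrm{Sol}^{\mathrm{dir}}_{w,\Lambda}(H_A(\beta))$. (2) The normalized coefficient $c^{(\lambda)}_\gamma$ depends only on $\mathrm{nsupp}(\gamma)$, hence can be denoted by $c_{\Lambda,I}$ for $I\in\mathrm{NS}(\Lambda)$, and the resulting finite family $\bm c=(c_{\Lambda,I})_{I\in\mathrm{NS}(\Lambda)}$ satisfies $$(A\partial_y)_i\bullet c_{\Lambda,I}=0\quad(I\in\mathrm{NS}(\Lambda),\ i=1,\dots,d),$$ $$\partial_y^{J\setminus I}\bullet c_{\Lambda,I}=\partial_y^{I\setminus J}\bullet c_{\Lambda,J}\quad(I,J\in\mathrm{NS}(\Lambda)),$$ $$c_{\Lambda,I}=0\quad(I\in\mathrm{NS}(\Lambda)\setminus\mathcal A_w(\Lambda)).$$ Under these equivalent conditions, the formula $r_\gamma=(\widetilde d_{\lambda\leftarrow\gamma}\bullet)^{-1}(\widetilde d_{\gamma\leftarrow\lambda}\bullet c_{\Lambda,\mathrm{nsupp}(\gamma)})$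 recovers the unique raw coefficient family, and $$\mathrm{Supp}(\varphi)=\coprod_{I\in\mathrm{Act}_\Lambda(\bm c)}\Lambda_I,\qquad\mathrm{Act}_\Lambda(\bm c)\subset\mathcal A_w(\Lambda),$$ where $\mathrm{Act}_\Lambda(\bm c)=\{I\in\mathrm{NS}(\Lambda)\mid c_{\Lambda,I}\ne0\}$. If $\varphi\ne0$, then $$\mathrm{lexp}_w(\varphi)=\min_{\le_w}\{v_{\Lambda,I}\mid I\in\mathrm{Act}_\Lambda(\bm c)\}.$$
   Context: Basics. $\mathbb N=\{0,1,2,\dots\}$, $[n]=\{1,\dots,n\}$. $A=(a_{ij})\in\mathrm{Mat}_{d\times n}(\mathbb Z)$ has rank $d$, $\beta\in\mathbb C^d$, $L=\mathrm{Ker}_{\mathbb Z}(A)$. An exponent lattice is a coset $\Lambda=\lambda+L$ with $\lambda\in\mathbb C^n$, $A\lambda=\beta$; $\mathfrak L_\beta$ is the set of all of them. Hypergeometric ideal. $D=\mathbb C\langle x_1,\dots,x_n,\partial_{x_1},\dots,\partial_{x_n}\rangle$ is the Weyl algebra, $\theta_{x_j}=x_j\partial_{x_j}$, $(A\theta_x)_i=\sum_ja_{ij}\theta_{x_j}$. For $u\in\mathbb Z^n$ write $u=u_+-u_-$ with $u_\pm\in\mathbb N^n$ of disjoint support. $I_A=\langle\partial_x^{u_+}-\partial_x^{u_-}\mid u\in L\rangle\subset\mathbb C[\partial_x]$, $H_A(\beta)=DI_A+\sum_{i=1}^dD((A\theta_x)_i-\beta_i)$. Formal series. $S=\mathbb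 C[\partial_{y_1},\dots,\partial_{y_n}]$ acts on $\mathbb C[y]$ by differentiation, written $\bullet$; $(A\partial_y)_i=\sum_ja_{ij}\partial_{y_j}$; $\partial_y^K=\prod_{j\in K}\partial_{y_j}$. $\widetilde\Lambda=\Lambda+\mathbb Z^n$. $\mathscr F^{\log}_{\widetilde\Lambda}$ is the space of all formal (possibly infinite) sums $\sum_{\gamma\in\widetilde\Lambda}x^\gamma p_\gamma(\log x)$, $p_\gamma\in\mathbb C[y]$, with coefficientwise equality, on which $D$ acts coefficientwise by $x_j\bullet(x^\gamma p(\log x))=x^{\gamma+e_j}p(\log x)$, $\partial_{x_j}\bullet(x^\gamma p(\log x))=x^{\gamma-e_j}((\gamma_j+\partial_{y_j})\bullet p)(\log x)$. $\mathrm{Supp}(\varphi)=\{\gamma\mid p_\gamma\ne0\}$; $\mathscr F^{\log}_{\widetilde\Lambda}[\Lambda]=\{\varphi\mid\mathrm{Supp}(\varphi)\subset\Lambda\}$. Supports and direction. $\mathrm{nsupp}(\gamma)=\{j\in[n]\mid\gamma_j\in\mathbb Z_{<0}\}$; $\Lambda_I=\{\gamma\in\Lambda\mid\mathrm{nsupp}(\gamma)=I\}$; $\mathrm{NS}(\Lambda)=\{I\mid\Lambda_I\ne\emptyset\}$. $w$ is $L$-generic if $w\cdot u\ne0$ for all $u\in L\setminus\{0\}$. On $\Lambda$, $\gamma\le_w\gamma'$ iff $w\cdot(\gamma'-\gamma)\ge0$ (a total order). $\mathcal B_w(\Lambda)$ is the set of $I\in\mathrm{NS}(\Lambda)$ such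 that $\{w\cdot(\gamma-\lambda)\mid\gamma\in\Lambda_I\}$ is bounded below in $\mathbb R$ (for one, equivalently any, $\lambda\in\Lambda$); for $I\in\mathcal B_w(\Lambda)$, $v_{\Lambda,I}$ is the (existing, unique) $\le_w$-minimum of $\Lambda_I$. $\mathcal A_w(\Lambda)$ is the set of $I\in\mathrm{NS}(\Lambda)$ such that every $J\in\mathrm{NS}(\Lambda)$ with $J\subset I$ lies in $\mathcal B_w(\Lambda)$; thus $\mathcal A_w(\Lambda)\subset\mathcal B_w(\Lambda)$. Solutions. $\mathrm{Sol}^{\mathrm{dir}}_{w,\Lambda}(H_A(\beta))$ is the set of $\varphi\in\mathscr F^{\log}_{\widetilde\Lambda}[\Lambda]$ with $H_A(\beta)\bullet\varphi=0$ such that $\varphi=0$ or $\mathrm{Supp}(\varphi)$ has a $\le_w$-minimum; for $\varphi\ne0$ this minimum is $\mathrm{lexp}_w(\varphi)$. Transit operators. For $\alpha\in\mathbb C^n$, $\nu\in\mathbb N^n$: $[\partial_y+\alpha]_\nu=\prod_{j=1}^n\prod_{k=0}^{\nu_j-1}(\partial_{y_j}+\alpha_j-k)$. For $\gamma,\gamma'\in\Lambda$: $d_{\gamma'\leftarrow\gamma}=[\partial_y+\gamma]_{(\gamma-\gamma')_+}\in S$, which is divisible in $S$ by $\partial_y^{\mathrm{nsupp}(\gamma')\setminus\mathrm{nsupp}(\gamma)}$, and $\widetilde d_{\gamma'\leftarrow\gamma}=d_{\gamma'\leftarrow\gamma}/\partial_y^{\mathrm{nsupp}(\gamma')\setminus\mathrm{nsupp}(\gamma)}$,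 which acts bijectively on $\mathbb C[y]$. *)

(* Defs.v *)
From HB Require Import structures.
From mathcomp Require Import all_boot all_order all_algebra.
From mathcomp Require Import complex mpoly.
From mathcomp Require Import boolp classical_sets functions reals.

Set Implicit Arguments.
Unset Strict Implicit.
Unset Printing Implicit Defensive.

Import Order.TTheory GRing.Theory Num.Theory.
Local Open Scope quotient_scope.
Local Open Scope ring_scope.
Local Open Scope classical_set_scope.

(* The Weyl algebra, as the quotient of the noncommutative polynomial
   expressions in x_j and d_j by the smallest congruence that contains the
   axioms of associative unital F-algebras and the canonical commutation
   relations. *)

Section WeylTerms.
Variables (F : comNzRingType) (n : nat).

Inductive weyl_term : Type :=
| WCst of F
| WVar of 'I_n
| WDer of 'I_n
| WAdd of weyl_term & weyl_term
| WMul of weyl_term & weyl_term.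

Inductive weyl_eq : weyl_term -> weyl_term -> Prop :=
| weyl_eq_refl t : weyl_eq t t
| weyl_eq_sym t u : weyl_eq t u -> weyl_eq u t
| weyl_eq_trans u t v : weyl_eq t u -> weyl_eq u v -> weyl_eq t v
| weyl_eq_congD t t' u u' :
    weyl_eq t t' -> weyl_eq u u' -> weyl_eq (WAdd t u) (WAdd t' u')
| weyl_eq_congM t t' u u' :
    weyl_eq t t' -> weyl_eq u u' -> weyl_eq (WMul t u) (WMul t' u')
| weyl_eq_addA t u v : weyl_eq (WAdd t (WAdd u v)) (WAdd (WAdd t u) v)
| weyl_eq_addC t u : weyl_eq (WAdd t u) (WAdd u t)
| weyl_eq_add0 t : weyl_eq (WAdd (WCst 0) t) t
| weyl_eq_addN t : weyl_eq (WAdd (WMul (WCst (-1)) t) t) (WCst 0)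
| weyl_eq_mulA t u v : weyl_eq (WMul t (WMul u v)) (WMul (WMul t u) v)
| weyl_eq_mul1l t : weyl_eq (WMul (WCst 1) t) t
| weyl_eq_mul1r t : weyl_eq (WMul t (WCst 1)) t
| weyl_eq_mulDl t u v :
    weyl_eq (WMul (WAdd t u) v) (WAdd (WMul t v) (WMul u v))
| weyl_eq_mulDr t u v :
    weyl_eq (WMul t (WAdd u v)) (WAdd (WMul t u) (WMul t v))
| weyl_eq_cstD a b : weyl_eq (WAdd (WCst a) (WCst b)) (WCst (a + b))
| weyl_eq_cstM a b : weyl_eq (WMul (WCst a) (WCst b)) (WCst (a * b))
| weyl_eq_cst_comm a t : weyl_eq (WMul (WCst a) t) (WMul t (WCst a))
| weyl_eq_var_comm i j :
    weyl_eq (WMul (WVar i) (WVar j)) (WMul (WVar j) (WVar i))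
| weyl_eq_der_comm i j :
    weyl_eq (WMul (WDer i) (WDer j)) (WMul (WDer j) (WDer i))
| weyl_eq_der_var i j :
    weyl_eq (WMul (WDer i) (WVar j))
            (WAdd (WMul (WVar j) (WDer i)) (WCst (i == j)%:R)).

HB.instance Definition _ := gen_eqMixin weyl_term.
HB.instance Definition _ := gen_choiceMixin weyl_term.

Definition weyl_eqb (t u : weyl_term) : bool := `[< weyl_eq t u >].

Lemma weyl_eqb_refl : reflexive weyl_eqb.
Proof. by move=> t; apply/asboolP; exact: weyl_eq_refl. Qed.

Lemma weyl_eqb_sym : ssrbool.symmetric weyl_eqb.
Proof. by move=> t u; apply/asboolP/asboolP => /weyl_eq_sym. Qed.

Lemma weyl_eqb_trans : transitive weyl_eqb.
Proof.
by move=> u t v /asboolP tu /asboolP uv; apply/asboolP; exact: weyl_eq_trans uv.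
Qed.

Canonical weyl_equiv :=
  EquivRel weyl_eqb weyl_eqb_refl weyl_eqb_sym weyl_eqb_trans.

Definition weyl : Type := {eq_quot weyl_equiv}.
HB.instance Definition _ := Choice.on weyl.
HB.instance Definition _ := Quotient.on weyl.

Lemma weyl_piP (t u : weyl_term) : weyl_eq t u <-> \pi_weyl t = \pi_weyl u.
Proof.
split=> [tu|/eqP]; first by apply/eqmodP/asboolP.
by move=> /eqP/eqmodP/asboolP.
Qed.

Lemma weyl_reprP (t : weyl_term) : weyl_eq (repr (\pi_weyl t)) t.
Proof. by apply/weyl_piP; rewrite reprK. Qed.

Definition weylC (a : F) : weyl := \pi_weyl (WCst a).
Definition weylX (j : 'I_n) : weyl := \pi_weyl (WVar j).
Definition weylD (j : 'I_n) : weyl := \pi_weyl (WDer j).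
Definition weyl_add (P Q : weyl) : weyl := \pi_weyl (WAdd (repr P) (repr Q)).
Definition weyl_mul (P Q : weyl) : weyl := \pi_weyl (WMul (repr P) (repr Q)).
Definition weyl_opp (P : weyl) : weyl := \pi_weyl (WMul (WCst (-1)) (repr P)).

Lemma weyl_pi_add t u : \pi_weyl (WAdd t u) = weyl_add (\pi t) (\pi u).
Proof.
by apply/weyl_piP; apply: weyl_eq_congD; apply/weyl_eq_sym/weyl_reprP. Qed.

Lemma weyl_pi_mul t u : \pi_weyl (WMul t u) = weyl_mul (\pi t) (\pi u).
Proof.
by apply/weyl_piP; apply: weyl_eq_congM; apply/weyl_eq_sym/weyl_reprP. Qed.

Lemma weyl_opp_mul P : weyl_opp P = weyl_mul (weylC (-1)) P.
Proof.
by apply/weyl_piP; apply: weyl_eq_congM;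
  [apply/weyl_eq_sym/weyl_reprP | exact: weyl_eq_refl].
Qed.

Lemma weyl_addrA : associative weyl_add.
Proof.
elim/quotW=> t; elim/quotW=> u; elim/quotW=> v; rewrite -!weyl_pi_add.
by apply/weyl_piP; exact: weyl_eq_addA.
Qed.

Lemma weyl_addrC : commutative weyl_add.
Proof.
elim/quotW=> t; elim/quotW=> u; rewrite -!weyl_pi_add.
by apply/weyl_piP; exact: weyl_eq_addC.
Qed.

Lemma weyl_add0r : left_id (weylC 0) weyl_add.
Proof.
by elim/quotW=> t; rewrite -!weyl_pi_add; apply/weyl_piP; exact: weyl_eq_add0.
Qed.

Lemma weyl_addNr : left_inverse (weylC 0) weyl_opp weyl_add.
Proof.
elim/quotW=> t; rewrite weyl_opp_mul -weyl_pi_mul -weyl_pi_add.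
by apply/weyl_piP; exact: weyl_eq_addN.
Qed.

HB.instance Definition _ :=
  GRing.isZmodule.Build weyl weyl_addrA weyl_addrC weyl_add0r weyl_addNr.

Lemma weyl_mulrA : associative weyl_mul.
Proof.
elim/quotW=> t; elim/quotW=> u; elim/quotW=> v; rewrite -!weyl_pi_mul.
by apply/weyl_piP; exact: weyl_eq_mulA.
Qed.

Lemma weyl_mul1r : left_id (weylC 1) weyl_mul.
Proof.
elim/quotW=> t; rewrite -!weyl_pi_mul.
by apply/weyl_piP; exact: weyl_eq_mul1l.
Qed.

Lemma weyl_mulr1 : right_id (weylC 1) weyl_mul.
Proof.
elim/quotW=> t; rewrite -!weyl_pi_mul.
by apply/weyl_piP; exact: weyl_eq_mul1r.
Qed.

Lemma weyl_mulrDl : left_distributive weyl_mul weyl_add.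
Proof.
elim/quotW=> t; elim/quotW=> u; elim/quotW=> v.
rewrite -!(weyl_pi_mul, weyl_pi_add).
by apply/weyl_piP; exact: weyl_eq_mulDl.
Qed.

Lemma weyl_mulrDr : right_distributive weyl_mul weyl_add.
Proof.
elim/quotW=> t; elim/quotW=> u; elim/quotW=> v.
rewrite -!(weyl_pi_mul, weyl_pi_add).
by apply/weyl_piP; exact: weyl_eq_mulDr.
Qed.

End WeylTerms.

(* A formal logarithmic series sum_g x^g p_g(log x) is the function g |-> p_g
   on all of F^n; the condition on the exponents is imposed separately. *)

Definition logseries (F : comNzRingType) (n : nat) : Type :=
  'cV[F]_n -> {mpoly F[n]}.
HB.instance Definition _ (F : comNzRingType) (n : nat) :=
  GRing.Zmodule.on (logseries F n).

Section WeylAction.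
Variables (F : comNzRingType) (n : nat).
Implicit Types (phi psi : logseries F n) (g : 'cV[F]_n).

Definition ebase (j : 'I_n) : 'cV[F]_n := delta_mx j 0.

Definition logmono g (p : {mpoly F[n]}) : logseries F n :=
  fun g' => if g' == g then p else 0.

Definition act_var (j : 'I_n) phi : logseries F n := fun g => phi (g - ebase j).

Definition act_der (j : 'I_n) phi : logseries F n := fun g =>
  (g + ebase j) j 0 *: phi (g + ebase j) + (phi (g + ebase j))^`M(j).

Lemma act_var_mono j g p : act_var j (logmono g p) = logmono (g + ebase j) p.
Proof. by apply/funext => g'; rewrite /act_var /logmono subr_eq. Qed.

Lemma act_der_mono j g p :
  act_der j (logmono g p) = logmono (g - ebase j) (g j 0 *: p + p^`M(j)).
Proof.
apply/funext => g'; rewrite /act_der /logmono [g' == _]eq_sym subr_eq eq_sym.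
by case: eqP => [->|_]; rewrite ?scaler0 ?mderiv0 ?addr0.
Qed.

Fixpoint act_term (t : weyl_term F n) phi : logseries F n :=
  match t with
  | WCst a => fun g => a *: phi g
  | WVar j => act_var j phi
  | WDer j => act_der j phi
  | WAdd t u => fun g => act_term t phi g + act_term u phi g
  | WMul t u => act_term t (act_term u phi)
  end.

Lemma act_termD t phi psi :
  act_term t (fun g => phi g + psi g) =
  (fun g => act_term t phi g + act_term t psi g).
Proof.
elim: t phi psi => [a|j|j|t IHt u IHu|t IHt u IHu] phi psi /=.
- by apply/funext => g; rewrite scalerDr.
- by [].
- by apply/funext => g; rewrite /act_der scalerDr mderivD addrACA.
- by apply/funext => g; rewrite IHt IHu addrACA.
- by rewrite IHu IHt.
Qed.

Lemma act_termZ t a phi :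
  act_term t (fun g => a *: phi g) = (fun g => a *: act_term t phi g).
Proof.
elim: t phi => [b|j|j|t IHt u IHu|t IHt u IHu] phi /=.
- by apply/funext => g; rewrite !scalerA mulrC.
- by [].
- apply/funext => g; rewrite /act_der mderivZ scalerDr !scalerA.
  by rewrite [X in X *: _]mulrC.
- by apply/funext => g; rewrite IHt IHu scalerDr.
- by rewrite IHu IHt.
Qed.

Lemma act_term_eq t u : weyl_eq t u -> act_term t = act_term u.
Proof.
elim=> {t u} //=.
- by move=> u t v _ -> _ ->.
- by move=> t t' u u' _ -> _ ->.
- by move=> t t' u u' _ -> _ ->.
- by move=> t u v; apply/funext => phi; apply/funext => g; rewrite addrA.
- by move=> t u; apply/funext => phi; apply/funext => g; rewrite addrC.
- by move=> t; apply/funext => phi; apply/funext => g; rewrite scale0r add0r.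
- move=> t; apply/funext => phi; apply/funext => g.
  by rewrite scaleN1r addNr scale0r.
- by move=> t; apply/funext => phi; apply/funext => g; rewrite scale1r.
- move=> t; apply/funext => phi; apply/funext => g; congr (act_term t _ _).
  by apply/funext => g'; rewrite scale1r.
- by move=> t u v; apply/funext => phi; rewrite act_termD.
- by move=> a b; apply/funext => phi; apply/funext => g; rewrite scalerDl.
- by move=> a b; apply/funext => phi; apply/funext => g; rewrite scalerA.
- by move=> a t; apply/funext => phi; rewrite act_termZ.
- move=> i j; apply/funext => phi; apply/funext => g.
  by rewrite /act_var addrAC.
- move=> i j; apply/funext => phi; apply/funext => g; rewrite /act_der.
  have [->//|ij] := eqVneq i j.
  have eE h k l : k != l -> (h + ebase k) l 0 = h l 0.
    by move=> kl; rewrite !mxE eq_sym (negbTE kl) addr0.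
  have -> : (g + ebase j + ebase i) i 0 = (g + ebase i) i 0.
    by rewrite addrAC (eE _ j i) // eq_sym.
  have -> : (g + ebase i + ebase j) j 0 = (g + ebase j) j 0.
    by rewrite addrAC (eE _ i j).
  rewrite [g + ebase j + ebase i]addrAC.
  set q := phi _; rewrite !mderivD !mderivZ !scalerDr !scalerA.
  rewrite [(g + ebase i) i 0 * _]mulrC [mderiv i (mderiv j q)]mderiv_comm.
  by rewrite -!addrA; congr (_ + _); rewrite addrCA.
- move=> i j; apply/funext => phi; apply/funext => g.
  rewrite /act_der /act_var; have [->|ij] := eqVneq i j.
    rewrite addrK subrK scale1r addrAC; congr (_ + _).
    by rewrite !mxE !eqxx scalerDl scale1r.
  rewrite scale0r addr0 [g - _ + _]addrAC; congr (_ *: _ + _).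
  by rewrite !mxE [i == j](negbTE ij) oppr0 addr0.
Qed.

Lemma weyl_oner_neq0 : weylC n (1 : F) != 0.
Proof.
apply/eqP => /weyl_piP/act_term_eq/(congr1 (fun f => f (logmono 0 1) 0)) /=.
by rewrite /logmono eqxx scale1r scale0r => /eqP; rewrite oner_eq0.
Qed.

HB.instance Definition _ := GRing.Zmodule_isNzRing.Build (weyl F n)
  (@weyl_mulrA F n) (@weyl_mul1r F n) (@weyl_mulr1 F n)
  (@weyl_mulrDl F n) (@weyl_mulrDr F n) weyl_oner_neq0.

Definition weyl_act (P : weyl F n) (phi : logseries F n) : logseries F n :=
  act_term (repr P) phi.

Lemma weyl_act_pi t phi : weyl_act (\pi_(weyl F n) t) phi = act_term t phi.
Proof. by rewrite /weyl_act (act_term_eq (weyl_reprP t)). Qed.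

Lemma weyl_actC a phi : weyl_act (weylC n a) phi = fun g => a *: phi g.
Proof. exact: weyl_act_pi. Qed.

Lemma weyl_actX j phi : weyl_act (weylX F j) phi = act_var j phi.
Proof. exact: weyl_act_pi. Qed.

Lemma weyl_actD j phi : weyl_act (weylD F j) phi = act_der j phi.
Proof. exact: weyl_act_pi. Qed.

Lemma weyl_act_add P Q phi :
  weyl_act (P + Q) phi = fun g => weyl_act P phi g + weyl_act Q phi g.
Proof. exact: weyl_act_pi. Qed.

Lemma weyl_act_mul P Q phi : weyl_act (P * Q) phi = weyl_act P (weyl_act Q phi).
Proof. exact: weyl_act_pi. Qed.

Lemma weyl_act1 phi : weyl_act 1 phi = phi.
Proof. by rewrite weyl_actC; apply/funext => g; rewrite scale1r. Qed.

End WeylAction.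

Definition left_ideal (T : nzRingType) (J : set T) : Prop :=
  [/\ J 0, forall a b, J a -> J b -> J (a + b) & forall a b, J b -> J (a * b)].

Section Hypergeometric.
Variables (R : realType) (d n : nat) (A : 'M[int]_(d, n)).
Local Notation C := R[i].
Implicit Types (g : 'cV[C]_n) (phi : logseries C n) (Lam : set 'cV[C]_n).
Implicit Types (beta : 'cV[C]_d) (w : 'cV[R]_n) (I J K : {set 'I_n}).
Implicit Types (c : {set 'I_n} -> {mpoly C[n]}).

Definition kerZ : set 'cV[int]_n := [set u | A *m u = 0].

Definition intvec (u : 'cV[int]_n) : 'cV[C]_n := map_mx intr u.

Definition exponent_lattices beta : set (set 'cV[C]_n) :=
  [set Lam | exists2 l, map_mx intr A *m l = beta
                      & Lam = [set l + intvec u | u in kerZ]].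

(* [Num.truncn] sends an integer to its positive part. *)
Definition pospart (u : 'cV[int]_n) : 'X_{1..n} :=
  [multinom Num.truncn (u j 0%R) | j < n].

Definition toric_ideal : set {mpoly C[n]} :=
  smallest (@left_ideal _)
    [set 'X_[pospart u] - 'X_[pospart (- u)] | u in kerZ].

Definition der_embed (P : {mpoly C[n]}) : weyl C n :=
  mmap (@weylC C n) (@weylD C n) P.

Definition euler (i : 'I_d) : weyl C n :=
  \sum_(j < n) (weylX C j * weylD C j) *~ A i j.

Definition hypergeometric_ideal beta : set (weyl C n) :=
  smallest (@left_ideal _)
    ((der_embed @` toric_ideal) `|`
     [set euler i - weylC n (beta i 0) | i in [set: 'I_d]]).

(* S = C[d_y] is represented by {mpoly C[n]}, with 'X_j standing for d_{y_j}. *)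
Definition dact (P p : {mpoly C[n]}) : {mpoly C[n]} :=
  \sum_(m <- msupp P) P@_m *: p^`M[m].

Definition Ader (i : 'I_d) : {mpoly C[n]} := \sum_(j < n) 'X_j *~ A i j.

Definition derset K : {mpoly C[n]} := \prod_(j in K) 'X_j.

Definition lattice_span Lam : set 'cV[C]_n :=
  [set g | exists2 l, Lam l & exists u, g = l + intvec u].

Definition logsupp phi : set 'cV[C]_n := [set g | phi g != 0].

Definition Flog (Lamt : set 'cV[C]_n) : set (logseries C n) :=
  [set phi | logsupp phi `<=` Lamt].

Definition Flog_on Lam : set (logseries C n) :=
  [set phi | Flog (lattice_span Lam) phi /\ logsupp phi `<=` Lam].

Definition nsupp g : {set 'I_n} :=
  [set j | `[< exists2 m : int, m < 0 & g j 0 = m%:~R >]]%SET.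

Definition stratum Lam I : set 'cV[C]_n := [set g | Lam g /\ nsupp g = I].

Definition NS Lam : set {set 'I_n} := [set I | stratum Lam I !=set0].

(* Only used on vectors with integer entries, for which this is w . v. *)
Definition wdot w (v : 'cV[C]_n) : R := \sum_(j < n) w j 0 * complex.Re (v j 0).

Definition L_generic w : Prop :=
  forall u, kerZ u -> u != 0 -> wdot w (intvec u) != 0.

Definition wle w g g' : Prop := 0 <= wdot w (g' - g).

Definition is_wmin w (X : set 'cV[C]_n) g : Prop :=
  X g /\ forall g', X g' -> wle w g g'.

Definition wmin w (X : set 'cV[C]_n) : 'cV[C]_n := xget 0 (is_wmin w X).

Definition Bw w Lam : set {set 'I_n} :=
  [set I | NS Lam I /\
    exists2 l, Lam l & has_lbound [set wdot w (g - l) | g in stratum Lam I]].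

Definition Aw w Lam : set {set 'I_n} :=
  [set I | NS Lam I /\ forall J, NS Lam J -> J \subset I -> Bw w Lam J].

Definition vmin w Lam I : 'cV[C]_n := wmin w (stratum Lam I).

Definition sol_dir w Lam beta : set (logseries C n) :=
  [set phi | [/\ Flog_on Lam phi,
    forall P, hypergeometric_ideal beta P -> weyl_act P phi = 0
    & phi = 0 \/ exists g, is_wmin w (logsupp phi) g]].

Definition lexp w phi : 'cV[C]_n := wmin w (logsupp phi).

Definition falling g (nu : 'X_{1..n}) : {mpoly C[n]} :=
  \prod_(j < n) \prod_(k < nu j) ('X_j + (g j 0 - k%:R)%:MP).

(* Positive part of a vector of C^n with integer entries. *)
Definition pospartC (v : 'cV[C]_n) : 'X_{1..n} :=
  [multinom Num.truncn (complex.Re (v j 0%R)) | j < n].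

(* [transit g' g] is d_{g' <- g}, and [ntransit g' g] is the quotient
   ~d_{g' <- g}, unique because S is a domain. *)
Definition transit g' g : {mpoly C[n]} := falling g (pospartC (g - g')).

Definition ntransit g' g : {mpoly C[n]} :=
  xget 0 [set q | transit g' g = q * derset (nsupp g' :\: nsupp g)].

Definition dact_inv (P p : {mpoly C[n]}) : {mpoly C[n]} :=
  xget 0 [set q | dact P q = p].

Definition ncoef (l : 'cV[C]_n) phi g : {mpoly C[n]} :=
  dact_inv (ntransit g l) (dact (ntransit l g) (phi g)).

(* Only the values of [c] on [NS Lam] matter. *)
Definition ncoef_family (l : 'cV[C]_n) Lam phi c : Prop :=
  forall g, Lam g -> ncoef l phi g = c (nsupp g).

Definition admissible_family w Lam c : Prop :=
  [/\ forall I i, NS Lam I -> dact (Ader i) (c I) = 0,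
      forall I J, NS Lam I -> NS Lam J ->
        dact (derset (J :\: I)) (c I) = dact (derset (I :\: J)) (c J)
    & forall I, NS Lam I -> ~ Aw w Lam I -> c I = 0].

Definition Act Lam c : set {set 'I_n} := [set I | NS Lam I /\ c I != 0].

End Hypergeometric.

(* Main.v *)
From HB Require Import structures.
Require Import Defs.
From mathcomp Require Import all_boot all_order all_algebra.
From mathcomp Require Import complex ssrcomplements mpoly.
From mathcomp Require Import boolp classical_sets functions reals.
From mathcomp Require Import ring.

Set Implicit Arguments.
Unset Strict Implicit.
Unset Printing Implicit Defensive.

Import Order.TTheory GRing.Theory Num.Theory.
Local Open Scope ring_scope.
Local Open Scope classical_set_scope.

(** The annihilator of a series is a left ideal, so being killed by
    [H_A(beta)] amounts to being killed by its generators. Coefficientwise,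
    the Euler operators say [A d_y . r_g = 0], and the binomial of [u] in
    [L] says [d_{h <- g} r_g = d_{g <- h} r_h] for exponents with [g - h =
    u] ([weyl_act_euler], [weyl_act_toric]).

    A transit operator is a product of factors [d_j + z]. On polynomials
    such a factor is invertible as soon as [z] is nonzero
    ([dact_linear_factor_bij]), and the factor with [z = 0] occurs exactly
    for the coordinates that pass from nonnegative to negative integers
    ([transit_split]). The invertible parts [~d] satisfy a cocycle relation,
    since along each coordinate they are quotients of one family of products
    ([regular_transit_cocycle]). Hence, after normalization at [l], the
    binomial equations lose their invertible parts and become [d^(nsupp h -
    nsupp g) c_g = d^(nsupp g - nsupp h) c_h] ([transit_ncoef]). For [nsupp
    g = nsupp h] this reads [c_g = c_h], so that [c] depends only on the
    negative support, and in general it is the gluing condition. As the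
    normalization is bijective, the support of the series is the union of
    the strata on which [c] is nonzero ([logsupp_strata]).

    It remains to match the direction conditions. If [J] is contained in
    [I], the gluing condition expresses [c_I] through [c_J]; so a nonzero
    [c_I] puts the stratum of [J] into the support, and a minimum of the
    support bounds it from below ([Act_sub_Aw]). Conversely, by Dickson's
    lemma every stratum on which [w] is bounded below has a minimum
    ([stratum_has_wmin]), and the support, a finite union of such strata,
    has one too. *)

(** * Constant-coefficient differential operators on polynomials *)

Section DifferentialOperators.
Variables (R : realType) (n : nat).
Local Notation C := R[i].
Local Notation T := {mpoly C[n]}.
Implicit Types (P Q p q : T).

Lemma dact_bound k P p : (msize P <= k)%N ->
  dact P p = \sum_(m : 'X_{1..n < k}) P@_m *: p^`M[m].
Proof.
move=> leP; rewrite /dact (big_mksub 'X_{1..n < k}) ?msupp_uniq //=; last first.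
  by move=> m /msize_mdeg_lt /leq_trans; apply.
by rewrite big_rmcond //= => m /memN_msupp_eq0 ->; rewrite scale0r.
Qed.

Lemma dactDl P Q p : dact (P + Q) p = dact P p + dact Q p.
Proof.
rewrite !(@dact_bound (maxn (msize P) (msize Q))) ?leq_maxl ?leq_maxr //.
  by rewrite -big_split; apply: eq_bigr => m _; rewrite mcoeffD scalerDl.
exact: msizeD_le.
Qed.

Lemma dactZl a P p : dact (a *: P) p = a *: dact P p.
Proof.
rewrite !(@dact_bound (msize P)) ?msizeZ_le //.
by rewrite scaler_sumr; apply: eq_bigr => m _; rewrite mcoeffZ scalerA.
Qed.

Lemma dact_is_linear P : linear (dact P).
Proof.
move=> a p q; rewrite /dact scaler_sumr -big_split; apply: eq_bigr => m _ /=.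
by rewrite mderivmD mderivmZ scalerDr !scalerA mulrC.
Qed.

HB.instance Definition _ P := GRing.isLinear.Build C T T *:%R (dact P)
  (dact_is_linear P).

Lemma dactX m p : dact 'X_[m] p = p^`M[m].
Proof. by rewrite /dact msuppX big_seq1 mcoeffX eqxx scale1r. Qed.

Lemma dact0l p : dact 0 p = 0.
Proof. by rewrite /dact msupp0 big_nil. Qed.

Lemma dactM P Q p : dact (P * Q) p = dact P (dact Q p).
Proof.
elim/mpolyind: P => [|a m P _ _ IHP]; first by rewrite mul0r !dact0l.
rewrite mulrDl !dactDl IHP -scalerAl !dactZl; congr (_ *: _ + _).
elim/mpolyind: Q {IHP} => [|b m' Q _ _ IHQ].
  by rewrite mulr0 dact0l linear0.
rewrite mulrDr !dactDl IHQ -scalerAr !dactZl linearD linearZ /= -mpolyXD !dactX.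
by rewrite addmC mderivmDm.
Qed.

Lemma dact1 p : dact 1 p = p.
Proof. by rewrite -mpolyX0 dactX mderivm0m. Qed.

Lemma dactC a p : dact a%:MP p = a *: p.
Proof. by rewrite -[a%:MP]mulr1 mul_mpolyC dactZl dact1. Qed.

Lemma dactXj j p : dact 'X_j p = p^`M(j).
Proof. by rewrite dactX mderivmU1m. Qed.

Lemma dact_commute P Q p : dact P (dact Q p) = dact Q (dact P p).
Proof. by rewrite -!dactM mulrC. Qed.

Lemma dact_nilpotent j p : dact ('X_j ^+ msize p) p = 0.
Proof.
rewrite mpolyXn dactX; apply/mpolyP => m.
rewrite mcoeff_mderivm mcoeff0 memN_msupp_eq0 ?mul0rn //.
by apply: msize_mdeg_ge; rewrite mdegD mdegMn mdeg1 mul1n leq_addr.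
Qed.

(** By the geometric sum ['X_j + a] divides [a ^+ k] up to a multiple of
    ['X_j ^+ k], and a high power of the derivative kills any given
    polynomial: on each polynomial the operator is inverted by the cofactor,
    whose length [k] depends on the polynomial. *)
Lemma dact_linear_factor_bij j (a : C) : a != 0 ->
  bijective (dact ('X_j + a%:MP : T)).
Proof.
move=> a0; pose P : T := 'X_j + a%:MP.
pose Q k : T := \sum_(i < k) a%:MP ^+ (k.-1 - i) * (- 'X_j) ^+ i.
have PQ k : P * Q k = (a ^+ k)%:MP - (- 'X_j) ^+ k.
  by rewrite /P addrC -[X in _ + X]opprK -subrXX rmorphXn.
have kills p : dact ((- 'X_j) ^+ msize p : T) p = 0.
  by rewrite exprNn dactM dact_nilpotent linear0.
have QP p : dact (Q (msize p)) (dact P p) = a ^+ msize p *: p.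
  rewrite -dactM mulrC PQ dactDl dactC -scaleN1r dactZl kills.
  by rewrite scaler0 addr0.
pose inv p := (a ^+ msize p)^-1 *: dact (Q (msize p)) p.
have invP p : dact P (inv p) = p.
  by rewrite linearZ /= dact_commute QP scalerA mulVf ?scale1r ?expf_neq0.
exists inv => // p; have inj q : dact P q = 0 -> q = 0.
  move=> Pq; have := QP q; rewrite Pq linear0 => /esym/eqP.
  by rewrite scaler_eq0 (negbTE (expf_neq0 _ a0)) => /eqP.
by apply/eqP; rewrite -subr_eq0; apply/eqP/inj; rewrite linearB /= invP subrr.
Qed.

Lemma dactM_bij P Q :
  bijective (dact P) -> bijective (dact Q) -> bijective (dact (P * Q)).
Proof.
by move=> bP bQ; apply: (eq_bij (bij_comp bP bQ)) => p; rewrite /= dactM.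
Qed.

Lemma dact_prod_bij (I : Type) (r : seq I) (B : pred I) (P : I -> T) :
  (forall i, B i -> bijective (dact (P i))) ->
  bijective (dact (\prod_(i <- r | B i) P i)).
Proof.
move=> bijP; elim/big_ind: _ => // [|p q]; last exact: dactM_bij.
by exists id => p; rewrite dact1.
Qed.

Lemma dact_invK P : bijective (dact P) -> cancel (dact P) (dact_inv P).
Proof.
move=> bijP p; apply: (bij_inj bijP).
by apply: (@xgetPex _ 0 [set q | dact P q = dact P p]); exists p.
Qed.

Lemma dact_invVK P : bijective (dact P) -> cancel (dact_inv P) (dact P).
Proof.
by move=> bijP p; have [inv _ invK] := bijP; rewrite -[p in LHS]invK dact_invK.
Qed.

End DifferentialOperators.

(** * Transit operators and their invertible parts *)

Section IntegerShifts.
Variables (R : realType).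
Local Notation C := R[i].

Lemma truncn_intE (m : int) : Num.truncn m = if m is Posz k then k else 0%N.
Proof.
case: m => k; first by rewrite -[Posz k]natz natrK.
by apply/truncn0Pn; rewrite -ltNge.
Qed.

Lemma ltn_truncn_int (k : nat) (m : int) : (k < Num.truncn m)%N = (k%:Z < m).
Proof. by rewrite truncn_intE; case: m => i //; rewrite ltnn. Qed.

Lemma truncn_intr (m : int) : Num.truncn (m%:~R : R) = Num.truncn m.
Proof.
rewrite truncn_intE; case: m => k; first by rewrite -pmulrn natrK.
by apply/truncn0Pn; rewrite NegzE -ltNge (lt_trans _ ltr01) // ltrz0.
Qed.

Lemma Re_intr (m : int) : complex.Re (m%:~R : C) = m%:~R.
Proof. by rewrite -(rmorph_int (real_complex R)). Qed.

End IntegerShifts.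

Lemma cyclic_cancel (D : idomainType) (a a' b b' c c' p q r : D) :
  p != 0 -> q != 0 -> r != 0 ->
  a * q = a' * p -> b * r = b' * q -> c * p = c' * r ->
  a * b * c = a' * b' * c'.
Proof.
move=> p0 q0 r0 eqa eqb eqc.
apply: (mulIf (mulf_neq0 (mulf_neq0 q0 r0) p0)).
by rewrite (mulrACA (a * b)) (mulrACA a) eqa eqb eqc; ring.
Qed.

Section Transit.
Variables (R : realType) (n : nat).
Local Notation C := R[i].
Local Notation T := {mpoly C[n]}.
Implicit Types (j : 'I_n) (a z : C) (g : 'cV[C]_n) (u v : 'cV[int]_n).

Lemma intvecE u j : intvec R u j 0 = (u j 0)%:~R.
Proof. by rewrite mxE. Qed.

Lemma intvecD u v : intvec R (u + v) = intvec R u + intvec R v.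
Proof. by apply/matrixP => i k; rewrite !mxE rmorphD. Qed.

Lemma intvecN u : intvec R (- u) = - intvec R u.
Proof. by apply/matrixP => i k; rewrite !mxE rmorphN. Qed.

Lemma intvecMn u k : intvec R (u *+ k) = intvec R u *+ k.
Proof. by apply/matrixP => i j; rewrite mxE !mulmxnE mxE rmorphMn. Qed.

Lemma pospartC_intvec u : pospartC (intvec R u) = pospart u.
Proof. by apply/mnmP => j; rewrite !mnmE intvecE Re_intr truncn_intr. Qed.

(** The shift [z = 0], whose factor ['X_j] is not invertible, is skipped:
    products of regular factors act bijectively. *)
Definition regular_factor j z : T := if z == 0 then 1 else 'X_j + z%:MP.

Definition regular_falling j a k : T :=
  \prod_(i < k) regular_factor j (a - i%:R).

Lemma regular_factor_neq0 j z : regular_factor j z != 0.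
Proof.
rewrite /regular_factor; have [_|z0] := eqVneq z 0; first by rewrite oner_eq0.
apply: contra z0 => /eqP/(congr1 (fun p : T => p@_0)).
by rewrite mcoeffD mcoeffX mcoeffC mcoeff0 eqxx mulr1 mnm1_eq0 add0r => ->.
Qed.

Lemma regular_falling_neq0 j a k : regular_falling j a k != 0.
Proof. by apply/prodf_neq0 => i _; exact: regular_factor_neq0. Qed.

Lemma regular_fallingD j a k m : regular_falling j a (k + m) =
  regular_falling j a k * regular_falling j (a - k%:R) m.
Proof.
rewrite /regular_falling big_split_ord; congr (_ * _).
by apply: eq_bigr => i _ /=; rewrite natrD opprD addrA.
Qed.

(** Both sides run over the shifts [z + k] with [0 < k <= max(p, q)]. *)
Lemma regular_falling_balance j z p q :
  regular_falling j (z + p%:R) (p - q) * regular_falling j (z + q%:R) q =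
  regular_falling j (z + q%:R) (q - p) * regular_falling j (z + p%:R) p.
Proof.
wlog qp : p q / (q <= p)%N => [hw|].
  by case/orP: (leq_total q p) => /hw.
have /eqP -> : (q - p == 0)%N by [].
have -> : regular_falling j (z + p%:R) p =
    regular_falling j (z + p%:R) (p - q) * regular_falling j (z + q%:R) q.
  rewrite -[X in regular_falling _ _ X = _](subnK qp) regular_fallingD.
  by rewrite natrB // opprB addrA (addrAC z) addrK.
by rewrite [X in _ = X * _]/regular_falling big_ord0 mul1r.
Qed.

(** With [P s] the falling product from [s] down to a common lower bound
    [m], the quotient [E s t / E t s] equals [P s / P t], and such quotients
    multiply to 1 around a triangle. *)
Lemma regular_falling_cocycle j a (x y z : int) :
  let E (s t : int) := regular_falling j (a + s%:~R) (Num.truncn (s - t)) in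
  E x y * E y z * E z x = E y x * E z y * E x z.
Proof.
move=> E.
have [m [mx my mz]] : exists m : int, [/\ m <= x, m <= y & m <= z].
  by exists (Num.min x (Num.min y z)); rewrite !ge_min !lexx !orbT.
pose P (s : int) := regular_falling j (a + s%:~R) `|s - m|%N.
have P0 s : P s != 0 by exact: regular_falling_neq0.
have balance (s t : int) : m <= s -> m <= t -> E s t * P t = E t s * P s.
  move=> ms mt.
  have shift (r : int) : m <= r -> r = m + (`|r - m|%N : int).
    move=> mr; rewrite gez0_abs ?subr_ge0 //. by rewrite addrCA subrr addr0.
  have := regular_falling_balance j (a + m%:~R) `|s - m|%N `|t - m|%N.
  have trB (r r' : int) : m <= r -> m <= r' ->
      (`|r - m| - `|r' - m|)%N = Num.truncn (r - r').
    move=> mr mr'; rewrite [in RHS](shift r) // [in RHS](shift r') //.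
    rewrite opprD addrACA subrr add0r truncn_intE.
    move: `|r - m|%N `|r' - m|%N => p q; case: (leqP q p) => pq.
      by rewrite subzn.
    rewrite (eqP (ltnW pq : (p - q == 0)%N)).
    by rewrite -opprB subzn 1?ltnW // -(prednK (n := q - p)) ?subn_gt0.
  rewrite !trB //.
  have sh (r : int) : m <= r -> a + m%:~R + (`|r - m|%N)%:R = a + r%:~R.
    by move=> mr; rewrite -addrA pmulrn -rmorphD /= -shift.
  by rewrite !sh.
exact: cyclic_cancel (P0 x) (P0 y) (P0 z) (balance x y mx my)
  (balance y z my mz) (balance z x mz mx).
Qed.

Definition regular_transit g' g : T :=
  \prod_j regular_falling j (g j 0) (pospartC (g - g') j).

Lemma regular_transit_cocycle g1 g2 g3 u v :
  g1 - g3 = intvec R u -> g2 - g3 = intvec R v ->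
  regular_transit g2 g1 * regular_transit g3 g2 * regular_transit g1 g3 =
  regular_transit g1 g2 * regular_transit g2 g3 * regular_transit g3 g1.
Proof.
move=> e1 e2; rewrite /regular_transit -!big_split; apply: eq_bigr => j _ /=.
pose x k : int := if k is 0%N then u j 0 else if k is 1%N then v j 0 else 0.
pose f k := if k is 0%N then g1 else if k is 1%N then g2 else g3.
have fE k : f k j 0 = g3 j 0 + (x k)%:~R.
  case: k => [|[|k]]; rewrite /f /x.
  - by rewrite -[g1](subrK g3) e1 !mxE addrC.
  - by rewrite -[g2](subrK g3) e2 !mxE addrC.
  - by rewrite addr0.
have fB k m : pospartC (f k - f m) j = Num.truncn (x k - x m).
  rewrite mnmE mxE [X in _ + X]mxE !fE opprD addrACA subrr add0r.
  by rewrite -rmorphB Re_intr truncn_intr.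
have := regular_falling_cocycle j (g3 j 0) (x 0%N) (x 1%N) (x 2%N).
by cbv zeta beta; rewrite -!fE -!fB.
Qed.

Lemma falling_factor_split j a k :
  \prod_(i < k) ('X_j + (a - i%:R)%:MP) =
  regular_falling j a k * (if [exists i : 'I_k, a == i%:R] then 'X_j else 1).
Proof.
have regular (i : 'I_k) : a != i%:R ->
    'X_j + (a - i%:R)%:MP = regular_factor j (a - i%:R).
  by rewrite /regular_factor subr_eq0 => /negbTE ->.
case: existsP => [[i0 /eqP ai0]|noi].
  rewrite /regular_falling (bigD1 i0) //= [in RHS](bigD1 i0) //=.
  rewrite ai0 subrr [regular_factor j 0]/regular_factor eqxx mpolyC0 addr0.
  rewrite mul1r mulrC.
  congr (_ * _); apply: eq_bigr => i ii0; rewrite -ai0 regular //.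
  by rewrite ai0 eqr_nat eq_sym.
rewrite mulr1; apply: eq_bigr => i _; apply: regular.
by apply/negP => ai; apply: noi; exists i.
Qed.

Lemma nsuppP g j :
  reflect (exists2 m : int, m < 0 & g j 0 = m%:~R) (j \in nsupp g).
Proof. by rewrite inE; exact: asboolP. Qed.

(** A falling product from [g] down to [g'] contains the factor [d_j] exactly
    when the [j]-th coordinate crosses from nonnegative to negative integers. *)
Lemma falling_crosses_zero g g' u j : g - g' = intvec R u ->
  [exists i : 'I_(Num.truncn (u j 0%R)), g j 0 == i%:R] =
  (j \in nsupp g' :\: nsupp g).
Proof.
move=> e; have gj : g j 0 = g' j 0 + (u j 0)%:~R.
  by rewrite -[g](subrK g') e !mxE addrC.
rewrite finset.in_setD; apply/existsP/andP.
  move=> [i /eqP gi].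
  have iu : i%:Z < u j 0 by rewrite -ltn_truncn_int ltn_ord.
  split.
    apply/nsuppP => -[m m0]; rewrite gi pmulrn => /intr_inj im.
    by rewrite -im in m0.
  apply/nsuppP; exists (i%:Z - u j 0); first by rewrite subr_lt0.
  by rewrite rmorphB /= -pmulrn -gi gj addrK.
move=> [/nsuppP gN /nsuppP[m m0 g'm]].
have : 0 <= m + u j 0.
  rewrite leNgt; apply/negP => mu; apply: gN; exists (m + u j 0) => //.
  by rewrite gj g'm rmorphD.
case mu: (m + u j 0) => [k|//] _.
have ku : (k < Num.truncn (u j 0%R))%N.
  by rewrite ltn_truncn_int -mu gtrDr.
by exists (Ordinal ku); rewrite gj g'm -rmorphD mu.
Qed.

Lemma transit_split g g' u : g - g' = intvec R u ->
  transit g' g = regular_transit g' g * derset R (nsupp g' :\: nsupp g).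
Proof.
move=> e; rewrite /derset big_mkcond /regular_transit -big_split.
apply: eq_bigr => j _ /=; rewrite falling_factor_split.
by rewrite e pospartC_intvec mnmE -(falling_crosses_zero j e).
Qed.

Lemma derset_neq0 (K : {set 'I_n}) : derset R K != 0.
Proof. by apply/prodf_neq0 => j _; rewrite -msize_poly_eq0 msizeX. Qed.

(** The quotient by the square-free monomial is unique in a domain, hence given
    by the regular factors. *)
Lemma ntransitE g g' u : g - g' = intvec R u ->
  ntransit g' g = regular_transit g' g.
Proof.
move=> e; apply: (mulIf (derset_neq0 (nsupp g' :\: nsupp g))).
rewrite -(transit_split e); apply/esym.
apply: (@xgetPex _ 0 [set q | transit g' g = q * _]).
by exists (regular_transit g' g); exact: transit_split e.
Qed.

Lemma regular_transit_bij g' g : bijective (dact (regular_transit g' g)).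
Proof.
apply: dact_prod_bij => j _; apply: dact_prod_bij => i _.
rewrite /regular_factor; case: eqP => [_|/eqP]; last first.
  exact: dact_linear_factor_bij.
by exists id => p; rewrite dact1.
Qed.

End Transit.

(** * The Weyl algebra acting on logarithmic series *)

Section WeylDerivatives.
Variables (F : comNzRingType) (n : nat).
Implicit Types (phi : logseries F n) (g : 'cV[F]_n) (j : 'I_n).

Lemma weyl_act0l phi : weyl_act 0 phi = 0.
Proof. by rewrite weyl_actC; apply/funext => g; rewrite scale0r. Qed.

Lemma weyl_act0r (P : weyl F n) : weyl_act P 0 = 0.
Proof.
by rewrite -(weyl_act0l 0) -weyl_act_mul mulr0.
Qed.

Lemma weyl_act_sum (I : Type) (r : seq I) (P : I -> weyl F n) phi g :
  weyl_act (\sum_(i <- r) P i) phi g = \sum_(i <- r) weyl_act (P i) phi g.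
Proof.
elim: r => [|i r IH]; first by rewrite !big_nil weyl_act0l.
by rewrite !big_cons weyl_act_add IH.
Qed.

Lemma weyl_act_opp (P : weyl F n) phi g :
  weyl_act (- P) phi g = - weyl_act P phi g.
Proof.
apply/eqP; rewrite -addr_eq0; have := weyl_act_add (- P) P phi.
by rewrite addNr weyl_act0l => /(congr1 (fun f => f g)) <-.
Qed.

Lemma weyl_act_mulz (P : weyl F n) (z : int) phi g :
  weyl_act (P *~ z) phi g = weyl_act P phi g *~ z.
Proof.
have nat k : weyl_act (P *+ k) phi g = weyl_act P phi g *+ k.
  elim: k => [|k IH]; first by rewrite weyl_act0l.
  by rewrite !mulrS weyl_act_add IH.
by case: z => k; rewrite ?NegzE ?mulrNz ?weyl_act_opp -!pmulrn nat.
Qed.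

Lemma weylD_comm i j : GRing.comm (weylD F i) (weylD F j).
Proof.
rewrite /GRing.comm /GRing.mul /= -!weyl_pi_mul; apply/weyl_piP.
exact: weyl_eq_der_comm.
Qed.

Lemma mmap1_weylD (m1 m2 : 'X_{1..n}) :
  mmap1 (@weylD F n) (m1 + m2) = mmap1 (@weylD F n) m1 * mmap1 (@weylD F n) m2.
Proof.
rewrite /mmap1; elim: (index_enum _) => [|j r IH].
  by rewrite !big_nil mulr1.
rewrite !big_cons mnmDE exprD IH -!mulrA; congr (_ * _).
rewrite !mulrA; congr (_ * _); apply: commr_prod => k _.
by apply: commrX; apply/commr_sym/commrX/weylD_comm.
Qed.

Lemma weylC_add (a b : F) : weylC n (a + b) = weylC n a + weylC n b.
Proof.
rewrite /GRing.add /= -weyl_pi_add; apply/esym/weyl_piP; exact: weyl_eq_cstD.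
Qed.

Lemma weylC_mul (a b : F) : weylC n (a * b) = weylC n a * weylC n b.
Proof.
rewrite [RHS]/GRing.mul /= -weyl_pi_mul; apply/esym/weyl_piP.
exact: weyl_eq_cstM.
Qed.

Fact weylC_is_zmod_morphism : zmod_morphism (@weylC F n).
Proof. by move=> a b; apply/eqP; rewrite eq_sym subr_eq -weylC_add subrK. Qed.

Fact weylC_is_monoid_morphism : monoid_morphism (@weylC F n).
Proof. by split=> // a b; exact: weylC_mul. Qed.

HB.instance Definition _ :=
  GRing.isZmodMorphism.Build F (weyl F n) (@weylC F n) weylC_is_zmod_morphism.
HB.instance Definition _ :=
  GRing.isMonoidMorphism.Build F (weyl F n) (@weylC F n)
    weylC_is_monoid_morphism.

Lemma weylC_comm a (P : weyl F n) : weylC n a * P = P * weylC n a.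
Proof.
elim/quotW: P => t; rewrite /GRing.mul /= -!weyl_pi_mul; apply/weyl_piP.
exact: weyl_eq_cst_comm.
Qed.

End WeylDerivatives.

Section DerivativeAction.
Variables (R : realType) (n : nat).
Local Notation C := R[i].
Local Notation T := {mpoly C[n]}.
Implicit Types (phi : logseries C n) (g : 'cV[C]_n) (j : 'I_n) (P Q : T).

Lemma der_embedX (m : 'X_{1..n}) : der_embed 'X_[m] = mmap1 (@weylD C n) m.
Proof. exact: mmapX. Qed.

Lemma der_embedZ a P : der_embed (a *: P) = weylC n a * der_embed P.
Proof. exact: mmapZ. Qed.

Lemma der_embedD P Q : der_embed (P + Q) = der_embed P + der_embed Q.
Proof. exact: mmapD. Qed.

Lemma der_embedB P Q : der_embed (P - Q) = der_embed P - der_embed Q.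
Proof. exact: mmapB. Qed.

Lemma der_embed0 : der_embed (0 : T) = 0.
Proof. exact: mmap0. Qed.

(** The Weyl algebra is not commutative, so multiplicativity rests on the
    derivatives commuting among themselves and the constants being central. *)
Lemma der_embedM P Q : der_embed (P * Q) = der_embed P * der_embed Q.
Proof.
elim/mpolyind: P => [|a m P _ _ IHP]; first by rewrite mul0r der_embed0 mul0r.
rewrite mulrDl !der_embedD IHP mulrDl -scalerAl !der_embedZ -mulrA.
congr (_ * _ + _); elim/mpolyind: Q {IHP} => [|b k Q _ _ IHQ].
  by rewrite mulr0 der_embed0 mulr0.
rewrite mulrDr !der_embedD IHQ mulrDr -scalerAr !der_embedZ -mpolyXD.
rewrite !der_embedX.
by rewrite mmap1_weylD mulrA weylC_comm -mulrA weylC_comm mulrA.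
Qed.

Lemma mulrn_ebaseE g j k : (g + ebase C j *+ k) j 0 = g j 0 + k%:R.
Proof. by rewrite !mxE mulmxnE !mxE !eqxx. Qed.

Lemma weyl_act_derX j k phi g : weyl_act (weylD C j ^+ k) phi g =
  dact (\prod_(i < k) ('X_j + ((g + ebase C j *+ k) j 0 - i%:R)%:MP))
    (phi (g + ebase C j *+ k)).
Proof.
elim: k g => [|k IH] g.
  by rewrite expr0 weyl_act1 big_ord0 mulr0n addr0 dact1.
rewrite exprS weyl_act_mul weyl_actD /act_der IH -addrA -mulrS.
set h := g + ebase C j *+ k.+1.
rewrite big_ord_recr /= mulrC dactM dactDl dactXj dactC [LHS]addrC.
congr (_ + _ *: _); rewrite /h -(mulr1n (ebase C j)) !mulrn_ebaseE.
by rewrite -(natr1 k) (addrC k%:R) addrA addrK.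
Qed.
Definition mnmvec (nu : 'X_{1..n}) : 'cV[C]_n := \col_j (nu j)%:R.

Lemma mnmvec_sum nu : mnmvec nu = \sum_j ebase C j *+ nu j.
Proof.
apply/matrixP => i k; rewrite summxE (bigD1 i) //= big1 => [|j ji].
  by rewrite ord1 addr0 !mxE mulmxnE !mxE !eqxx.
by rewrite mulmxnE !mxE eq_sym (negbTE ji) mul0rn.
Qed.

(** A derivative in one variable only shifts that coordinate of the exponent, so
    each factor already sees its own coordinate of the total shift [h]. *)
Lemma weyl_act_derXs (r : seq 'I_n) (nu : 'X_{1..n}) phi g : uniq r ->
  let h := g + \sum_(j <- r) ebase C j *+ nu j in
  weyl_act (\prod_(j <- r) weylD C j ^+ nu j) phi g =
  dact (\prod_(j <- r) \prod_(i < nu j) ('X_j + (h j 0 - i%:R)%:MP)) (phi h).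
Proof.
elim: r g => [|j r IH] g /=.
  by rewrite !big_nil weyl_act1 addr0 dact1.
case/andP => jr ur; rewrite !big_cons weyl_act_mul weyl_act_derX IH // -dactM.
rewrite -addrA; set h := g + (_ + _); congr (dact (_ * _) _).
apply: eq_bigr => i _; congr ('X_j + (_ - _)%:MP).
rewrite /h !mxE; congr (_ + _); rewrite -[LHS]addr0; congr (_ + _).
rewrite summxE big_seq big1 // => k kr; rewrite mulmxnE !mxE.
by case: eqP => [jk|]; [rewrite jk kr in jr | rewrite mul0rn].
Qed.

Lemma weyl_act_der_embedX (nu : 'X_{1..n}) phi g :
  weyl_act (der_embed 'X_[nu]) phi g =
  dact (falling (g + mnmvec nu) nu) (phi (g + mnmvec nu)).
Proof.
rewrite der_embedX mnmvec_sum.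
exact: weyl_act_derXs (index_enum_uniq _).
Qed.

Lemma pospart_sub (u : 'cV[int]_n) :
  mnmvec (pospart u) - mnmvec (pospart (- u)) = intvec R u.
Proof.
apply/matrixP => i k; rewrite ord1 !mxE !mnmE !mxE !truncn_intE.
case: (u i 0) => [[|m]|m] /=; rewrite ?subr0 ?sub0r //.
Qed.

(** A binomial generator relates exactly two coefficients of the series, whose
    exponents differ by [u]. *)
Lemma weyl_act_toric u phi g :
  let h := g + mnmvec (pospart u) in
  let h' := g + mnmvec (pospart (- u)) in
  weyl_act (der_embed ('X_[pospart u] - 'X_[pospart (- u)])) phi g =
  dact (transit h' h) (phi h) - dact (transit h h') (phi h').
Proof.
move=> h h'; rewrite der_embedB weyl_act_add weyl_act_opp.
rewrite !weyl_act_der_embedX -/h -/h' /transit.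
have -> : h - h' = intvec R u by rewrite opprD addrACA subrr add0r pospart_sub.
have -> : h' - h = intvec R (- u).
  by rewrite opprD addrACA subrr add0r -pospart_sub opprK.
by rewrite !pospartC_intvec.
Qed.

End DerivativeAction.

Section HypergeometricIdeal.
Variables (R : realType) (d n : nat) (A : 'M[int]_(d, n)) (beta : 'cV[R[i]]_d).
Local Notation C := R[i].
Local Notation T := {mpoly C[n]}.
Implicit Types (phi : logseries C n) (g : 'cV[C]_n).

Lemma dact_Ader i (p : T) : dact (Ader R A i) p = \sum_j p^`M(j) *~ A i j.
Proof.
rewrite /Ader; elim: (index_enum _) => [|j r IH].
  by rewrite !big_nil dact0l.
by rewrite !big_cons dactDl IH -scaler_int dactZl dactXj scaler_int.
Qed.

(** On exponents satisfying [A g = beta] the scalar part of the Euler operator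
    vanishes and only its action on logarithms remains. *)
Lemma weyl_act_euler i phi g :
  weyl_act (euler R A i - weylC n (beta i 0)) phi g =
  (map_mx intr A *m g - beta) i 0 *: phi g + dact (Ader R A i) (phi g).
Proof.
rewrite weyl_act_add weyl_act_opp weyl_actC weyl_act_sum dact_Ader.
rewrite [(_ - beta) i 0]mxE [(- beta) i 0]mxE scalerBl addrAC; congr (_ - _).
rewrite mxE scaler_suml -big_split; apply: eq_bigr => j _ /=.
rewrite weyl_act_mulz weyl_act_mul weyl_actX weyl_actD /act_var /act_der subrK.
by rewrite mulrzDl mxE -scalerA scaler_int.
Qed.

Lemma left_ideal_annihilator phi : left_ideal [set P | weyl_act P phi = 0].
Proof.
split=> [|P Q /= Pphi Qphi|P Q /= Qphi].
- exact: weyl_act0l.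
- by rewrite weyl_act_add Pphi Qphi; apply/funext => g; rewrite addr0.
- by rewrite weyl_act_mul Qphi weyl_act0r.
Qed.

Lemma smallestE (X : nzRingType) (G : set X) (J : set X) : left_ideal J ->
  G `<=` J -> smallest (@left_ideal X) G `<=` J.
Proof. by move=> idJ GJ x; apply. Qed.

(** The annihilator of [phi] is a left ideal, in the Weyl algebra as well as
    in its commutative subring of derivatives, so it suffices to test
    generators. *)
Lemma hypergeometric_annihilates phi :
  (forall P, hypergeometric_ideal A beta P -> weyl_act P phi = 0) <->
  (forall i, weyl_act (euler R A i - weylC n (beta i 0)) phi = 0) /\
  (forall u, kerZ A u ->
     weyl_act (der_embed ('X_[pospart u] - 'X_[pospart (- u)])) phi = 0).
Proof.
split=> [ann|[annE annT] P].
  split=> [i|u uL]; apply: ann.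
    by move=> J [_ GJ]; apply: GJ; right; exists i.
  move=> J [_ GJ]; apply: GJ; left.
  by eexists; last reflexivity; move=> J' [_ GJ']; apply: GJ'; exists u.
apply: (smallestE (left_ideal_annihilator phi)) => _ [[Q toricQ <-]|[i _ <-]].
  apply: (smallestE (J := [set Q | weyl_act (der_embed Q) phi = 0])) toricQ.
    have [ann0 annD annM] := left_ideal_annihilator phi.
    split=> [|P1 P2|P1 P2]; rewrite /= ?der_embed0 ?der_embedD ?der_embedM.
    - exact: ann0.
    - exact: annD.
    - exact: annM.
  by move=> _ [u uL <-]; exact: annT.
exact: annE.
Qed.

End HypergeometricIdeal.

(** * Minima of strata of an exponent lattice *)

(** Dickson's lemma, by induction on the coordinates: a finite set that
    serves all coordinates but [j] also serves [j] at the points where [f j]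
    is at least the maximum [M] over that set, and each of the finitely many
    slices [f j = m < M] needs only the other coordinates. *)
Lemma dickson (K T : eqType) (f : K -> T -> nat) (s : seq K) (X : set T) :
  exists2 F : seq T, (forall y, y \in F -> X y) &
    forall x, X x -> exists2 y, y \in F & {in s, forall j, f j y <= f j x}%N.
Proof.
elim: s X => [|j s IH] X.
  have [[x0 Xx0]|noX] := pselect (exists x, X x).
    exists [:: x0] => [y|x _]; first by rewrite inE => /eqP ->.
    by exists x0; rewrite ?inE.
  by exists [::] => // x Xx; case: noX; exists x.
have [F0 F0X F0P] := IH X.
pose M := \max_(y <- F0) f j y.
have slices m : exists2 F : seq T, (forall y, y \in F -> X y) &
    forall x, X x -> (f j x < m)%N ->
      exists2 y, y \in F & {in j :: s, forall k, f k y <= f k x}%N.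
  elim: m => [|m [F FX FP]]; first by exists [::].
  have [G GX GP] := IH [set x | X x /\ f j x = m].
  exists (F ++ G) => [y|x Xx].
    by rewrite mem_cat => /orP[/FX|/GX []].
  rewrite ltnS leq_eqVlt => /orP[/eqP fx|fx].
    have [y yG yP] := GP x (conj Xx fx).
    exists y; first by rewrite mem_cat yG orbT.
    move=> k; rewrite inE => /predU1P[->|/yP //].
    by have [_ ->] := GX y yG; rewrite fx.
  by have [y yF yP] := FP x Xx fx; exists y; rewrite ?mem_cat ?yF.
have [G GX GP] := slices M.
exists (F0 ++ G) => [y|x Xx]; first by rewrite mem_cat => /orP[/F0X|/GX].
have [Mx|xM] := leqP M (f j x).
  have [y yF yP] := F0P x Xx; exists y; first by rewrite mem_cat yF.
  move=> k; rewrite inE => /predU1P[->|/yP //].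
  by apply: leq_trans Mx; exact: leq_bigmax_seq.
by have [y yG yP] := GP x Xx xM; exists y; rewrite ?mem_cat ?yG ?orbT.
Qed.

Lemma seq_minimum (R : realDomainType) (T : eqType) (v : T -> R)
    (s : seq T) x0 :
  x0 \in s -> exists2 x, x \in s & {in s, forall y, v x <= v y}.
Proof.
elim: s x0 => // a s IH x0 _.
case: s IH => [|b s] IH.
  by exists a => [|y]; rewrite ?inE // => /eqP ->.
have [x xs xmin] := IH b (mem_head _ _).
have [ax|xa] := leP (v a) (v x).
  exists a => [|y]; rewrite ?mem_head // inE => /predU1P[-> //|/xmin].
  exact: le_trans.
exists x => [|y]; first by rewrite inE xs orbT.
by rewrite inE => /predU1P[->|/xmin //]; exact: ltW.
Qed.

Section LatticeMinima.
Variables (R : realType) (d n : nat) (A : 'M[int]_(d, n)) (beta : 'cV[R[i]]_d).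
Variables (w : 'cV[R]_n) (Lam : set 'cV[R[i]]_n).
Local Notation C := R[i].
Implicit Types (g h : 'cV[C]_n) (u : 'cV[int]_n) (X : set 'cV[C]_n).
Hypothesis latLam : exponent_lattices A beta Lam.

Lemma wdotD g h : wdot w (g + h) = wdot w g + wdot w h.
Proof.
rewrite /wdot -big_split; apply: eq_bigr => j _ /=.
by rewrite mxE -mulrDr; congr (_ * _); case: (g j 0) (h j 0) => [? ?] [].
Qed.

Lemma wdotN g : wdot w (- g) = - wdot w g.
Proof.
rewrite /wdot -sumrN; apply: eq_bigr => j _.
by rewrite mxE -mulrN; congr (_ * _); case: (g j 0).
Qed.

Lemma wdotMn g k : wdot w (g *+ k) = wdot w g *+ k.
Proof.
elim: k => [|k IH]; last by rewrite !mulrS wdotD IH.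
by rewrite /wdot big1 // => j _; rewrite mxE mulr0.
Qed.

Lemma wleE g h : wle w g h <-> wdot w g <= wdot w h.
Proof. by rewrite /wle wdotD wdotN subr_ge0. Qed.

Lemma lattice_sub g h :
  Lam g -> Lam h -> exists2 u, kerZ A u & g - h = intvec R u.
Proof.
have [l0 _ ->] := latLam; move=> [u uL <-] [v vL <-].
exists (u - v); first by rewrite /kerZ /= mulmxBr uL vL subr0.
by rewrite intvecD intvecN opprD addrACA subrr add0r.
Qed.

Lemma lattice_shift g u : Lam g -> kerZ A u -> Lam (g + intvec R u).
Proof.
have [l0 _ ->] := latLam; move=> [v vL <-] uL.
exists (v + u); first by rewrite /kerZ /= mulmxDr uL vL addr0.
by rewrite intvecD addrA.
Qed.

Lemma lattice_homogeneous g : Lam g -> map_mx intr A *m g = beta.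
Proof.
have [l0 <- ->] := latLam; move=> [u uL <-].
rewrite mulmxDr -[RHS]addr0; congr (_ + _).
by rewrite /intvec -map_mxM uL map_mx0.
Qed.

Definition absint (z : C) : nat := Num.truncn `|complex.Re z|.

Lemma absintE (m : int) : absint m%:~R = `|m|%N.
Proof. by rewrite /absint Re_intr -intr_norm -abszE -pmulrn natrK. Qed.

(** A coordinate whose sign type is shared by [g] and [g + u], and along which
    [u] moves away from zero, keeps this sign type along the whole ray. *)
Lemma stratum_ray I g u : stratum Lam I g -> stratum Lam I (g + intvec R u) ->
  kerZ A u ->
  (forall j, absint (g j 0%R) <= absint ((g + intvec R u)%R j 0%R))%N ->
  forall k, stratum Lam I (g + intvec R u *+ k).
Proof.
move=> [Lg gI] [_ guI] uL away k; split.
  rewrite -intvecMn; apply: (lattice_shift Lg); rewrite /kerZ /=.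
  elim: k => [|k IH]; first by rewrite mulmx0.
  by rewrite mulrS mulmxDr uL IH addr0.
have jE j : (g + intvec R u *+ k) j 0 = g j 0 + (u j 0 *+ k)%:~R.
  by rewrite mxE mulmxnE mxE rmorphMn.
apply/setP => j; apply/nsuppP/idP => [[m m0]|].
  rewrite jE => /eqP; rewrite -subr_eq0 -addrA -rmorphB /= addr_eq0 -rmorphN /=.
  rewrite opprB => /eqP gj; rewrite -gI; apply/nsuppP.
  exists (m - u j 0 *+ k) => //.
  rewrite ltNge; apply/negP => p0.
  have guj : (g + intvec R u) j 0 = (m - u j 0 *+ k + u j 0)%:~R.
    by rewrite mxE gj mxE -rmorphD.
  have q0 : 0 <= m - u j 0 *+ k + u j 0.
    rewrite leNgt; apply/negP => q0.
    have : j \in nsupp (g + intvec R u).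
      by apply/nsuppP; eexists; [exact: q0|].
    rewrite guI -gI => /nsuppP[m' m'0]; rewrite gj => /intr_inj pm'.
    by rewrite pm' leNgt m'0 in p0.
  have := away j; rewrite guj gj !absintE -lez_nat !gez0_abs // lerDl => u0.
  have : 0 <= m - u j 0 *+ k + u j 0 *+ k by rewrite addr_ge0 // mulrn_wge0.
  by rewrite subrK leNgt m0.
rewrite -{1}gI => jg; have [m m0 gj] := nsuppP g j jg.
have : j \in nsupp (g + intvec R u) by rewrite guI -gI.
case/nsuppP => m' m'0 guj; rewrite jE gj.
have um : m' = m + u j 0.
  by apply: (@intr_inj C); rewrite -guj mxE gj mxE rmorphD.
have := away j; rewrite guj gj !absintE -lez_nat !ltz0_abs // lerN2 um.
rewrite gerDl => u0.
exists (m + u j 0 *+ k); last by rewrite rmorphD.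
by apply: le_lt_trans m0; rewrite gerDl mulrn_wle0.
Qed.

(** By Dickson's lemma finitely many points of the stratum suffice to reach any
    other point by a step along a ray inside the stratum, and a lower bound
    forces [w] to be nonnegative on such steps. *)
Lemma stratum_has_wmin I : Bw w Lam I ->
  exists g, is_wmin w (stratum Lam I) g.
Proof.
move=> [[g0 Ig0] [l Ll [B lbB]]].
have [F FI FP] :=
  @dickson _ _ (fun j g => absint (g j 0%R)) (enum 'I_n) (stratum Lam I).
have [y0 y0F _] := FP g0 Ig0.
have [y yF ymin] := seq_minimum (wdot w) y0F.
exists y; split=> [|g Ig]; first exact: FI.
have [h hF hg] := FP g Ig; apply/wleE; apply: le_trans (ymin h hF) _.
have [u uL gh] : exists2 u, kerZ A u & g - h = intvec R u.
  by apply: lattice_sub; [case: Ig | case: (FI h hF)].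
have gE : g = h + intvec R u by rewrite -gh addrC subrK.
have ray : forall k, stratum Lam I (h + intvec R u *+ k).
  apply: stratum_ray; rewrite -?gE //; first exact: FI.
  by move=> j; apply: hg; rewrite mem_enum.
rewrite gE wdotD lerDl leNgt; apply/negP => wu.
pose e := wdot w (h - l) - B.
have e0 k : 0 <= e + wdot w (intvec R u) *+ k.
  rewrite /e addrAC subr_ge0 -wdotMn -wdotD; apply: lbB.
  by exists (h + intvec R u *+ k) => //; rewrite addrAC.
have := e0 (Num.truncn (e / - wdot w (intvec R u))).+1.
rewrite -mulr_natr -[X in X * _]opprK mulNr subr_ge0 mulrC leNgt.
by rewrite -ltr_pdivrMr ?oppr_gt0 // truncnS_gt.
Qed.

End LatticeMinima.

(** * Normalized coefficients *)

Lemma bij_eq_transport (X Y : Type) (f g : X -> Y) x x' y y' :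
  bijective f -> bijective g -> f x = g y -> f x' = g y' -> x = x' <-> y = y'.
Proof.
move=> bijf bijg fx fx'; split=> [xx'|yy'].
  by apply: (bij_inj bijg); rewrite -fx -fx' xx'.
by apply: (bij_inj bijf); rewrite fx fx' yy'.
Qed.

Section NormalizedCoefficients.
Variables (R : realType) (d n : nat) (A : 'M[int]_(d, n)) (beta : 'cV[R[i]]_d).
Variables (Lam : set 'cV[R[i]]_n) (l : 'cV[R[i]]_n).
Local Notation C := R[i].
Local Notation T := {mpoly C[n]}.
Implicit Types (g h : 'cV[C]_n) (phi : logseries C n) (P p : T).
Hypothesis latLam : exponent_lattices A beta Lam.
Hypothesis Ll : Lam l.

Lemma ntransit_bij g h : Lam g -> Lam h -> bijective (dact (ntransit h g)).
Proof.
move=> Lg Lh; have [u _ e] := lattice_sub latLam Lg Lh.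
by rewrite (ntransitE e); exact: regular_transit_bij.
Qed.

Lemma dact_eq0 P p : bijective (dact P) -> dact P p = 0 <-> p = 0.
Proof.
move=> bijP; split=> [|->]; last exact: linear0.
by rewrite -[RHS](linear0 (dact P)); exact: bij_inj.
Qed.

Lemma ncoefE phi g : Lam g ->
  dact (ntransit g l) (ncoef l phi g) = dact (ntransit l g) (phi g).
Proof. by move=> Lg; rewrite /ncoef dact_invVK //; exact: ntransit_bij. Qed.

Lemma coef_recover phi g : Lam g ->
  phi g = dact_inv (ntransit l g) (dact (ntransit g l) (ncoef l phi g)).
Proof. by move=> Lg; rewrite ncoefE // dact_invK //; exact: ntransit_bij. Qed.

Lemma ncoef_eq0 phi g : Lam g -> ncoef l phi g = 0 <-> phi g = 0.
Proof.
move=> Lg; rewrite -(dact_eq0 _ (ntransit_bij Ll Lg)) ncoefE //.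
by apply: dact_eq0; exact: ntransit_bij.
Qed.

Lemma ncoef_dact_eq0 P phi g : Lam g ->
  dact P (phi g) = 0 <-> dact P (ncoef l phi g) = 0.
Proof.
move=> Lg; rewrite -(dact_eq0 _ (ntransit_bij Lg Ll)) dact_commute -ncoefE //.
by rewrite dact_commute; apply: dact_eq0; exact: ntransit_bij.
Qed.

(** The factor [~d_{l <- g}] trades the raw coefficient at [g] for the
    normalized one; [~d_{l <- h}] does the same at [h] when the roles are
    exchanged, which makes the two sides of the transit equation comparable. *)
Lemma transit_regular phi g h : Lam g -> Lam h ->
  dact (regular_transit l g * regular_transit l h)
    (dact (transit h g) (phi g)) =
  dact (regular_transit g l * regular_transit h g * regular_transit l h)
    (dact (derset R (nsupp h :\: nsupp g)) (ncoef l phi g)).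
Proof.
move=> Lg Lh; have [u _ egh] := lattice_sub latLam Lg Lh.
have [v _ egl] := lattice_sub latLam Lg Ll.
have [x _ elg] := lattice_sub latLam Ll Lg.
have := ncoefE phi Lg; rewrite (ntransitE egl) (ntransitE elg) => cg.
rewrite (transit_split egh) !dactM.
rewrite 3!(dact_commute (regular_transit l g)) -cg.
rewrite 3!(dact_commute (regular_transit g l)).
exact: dact_commute.
Qed.

(** The transit equation is multiplied by the invertible
    [~d_{l <- g} ~d_{l <- h}], which turns raw into normalized coefficients; by
    the cocycle relation the invertible operators appearing on the two sides
    coincide and cancel, leaving only the singular parts. *)
Lemma transit_ncoef phi g h : Lam g -> Lam h ->
  dact (transit h g) (phi g) = dact (transit g h) (phi h) <->
  dact (derset R (nsupp h :\: nsupp g)) (ncoef l phi g) =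
  dact (derset R (nsupp g :\: nsupp h)) (ncoef l phi h).
Proof.
move=> Lg Lh; have [u _ egh] := lattice_sub latLam Lg Lh.
have [v _ elh] := lattice_sub latLam Ll Lh.
have sideg := transit_regular phi Lg Lh.
have sideh := transit_regular phi Lh Lg.
have eqW : regular_transit l h * regular_transit l g =
    regular_transit l g * regular_transit l h by exact: mulrC.
have eqV : regular_transit h l * regular_transit g h * regular_transit l g =
    regular_transit g l * regular_transit h g * regular_transit l h.
  by rewrite (regular_transit_cocycle elh egh) mulrAC -mulrA mulrC.
rewrite eqW eqV in sideh.
have bijW := dactM_bij (regular_transit_bij l g) (regular_transit_bij l h).
have bijV := dactM_bij (dactM_bij (regular_transit_bij g l)
  (regular_transit_bij h g)) (regular_transit_bij l h).
exact: bij_eq_transport bijW bijV sideg sideh.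
Qed.

Lemma toric_transit phi : logsupp phi `<=` Lam ->
  (forall u, kerZ A u ->
     weyl_act (der_embed ('X_[pospart u] - 'X_[pospart (- u)])) phi = 0) <->
  (forall g h, Lam g -> Lam h ->
     dact (transit h g) (phi g) = dact (transit g h) (phi h)).
Proof.
move=> suppL; split=> [ann g h Lg Lh|eqs u uL].
  have [u uL gh] := lattice_sub latLam Lg Lh.
  have /(congr1 (fun f => f (g - mnmvec R (pospart u)))) := ann u uL.
  rewrite weyl_act_toric subrK.
  have -> : g - mnmvec R (pospart u) + mnmvec R (pospart (- u)) = h.
    rewrite -addrA [X in g + X]addrC -opprB pospart_sub -gh opprB addrC.
    exact: subrK.
  by move/eqP; rewrite subr_eq0 => /eqP.
apply/funext => g; rewrite weyl_act_toric.
set b := g + mnmvec R (pospart u); set b' := g + _.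
have bb' : b = b' + intvec R u.
  rewrite /b /b' -pospart_sub -addrA.
  by rewrite [in RHS](addrC (mnmvec R (pospart (- u)))) subrK.
have off x : ~ Lam x -> phi x = 0.
  by move=> Lx; apply/eqP/negPn/negP => /suppL.
have [Lb|Lb] := pselect (Lam b).
  rewrite (eqs b b') ?subrr // (_ : b' = b + intvec R (- u)); last first.
    by rewrite intvecN bb' addrK.
  by apply: (lattice_shift latLam) => //; rewrite /kerZ /= mulmxN uL oppr0.
rewrite !off ?linear0 ?oppr0 ?addr0 // => Lb'; apply: Lb; rewrite bb'.
exact: (lattice_shift latLam).
Qed.

Lemma euler_dact phi i : logsupp phi `<=` Lam ->
  weyl_act (euler R A i - weylC n (beta i 0)) phi = 0 <->
  (forall g, Lam g -> dact (Ader R A i) (phi g) = 0).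
Proof.
move=> suppL; have eulerE g : Lam g ->
      weyl_act (euler R A i - weylC n (beta i 0)) phi g =
      dact (Ader R A i) (phi g).
  move=> Lg; rewrite weyl_act_euler (lattice_homogeneous latLam Lg) subrr.
  by rewrite mxE scale0r add0r.
split=> [ann g Lg|eqs]; first by rewrite -eulerE // ann.
apply/funext => g; have [Lg|Lg] := pselect (Lam g).
  by rewrite eulerE ?eqs.
have phig : phi g = 0 by apply/eqP/negPn/negP => /suppL.
by rewrite weyl_act_euler phig !linear0 addr0.
Qed.

Lemma annihilated_ncoef phi : logsupp phi `<=` Lam ->
  (forall Q : weyl C n,
     hypergeometric_ideal A beta Q -> weyl_act Q phi = 0) <->
  (forall g i, Lam g -> dact (Ader R A i) (ncoef l phi g) = 0) /\
  (forall g h, Lam g -> Lam h ->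
     dact (derset R (nsupp h :\: nsupp g)) (ncoef l phi g) =
     dact (derset R (nsupp g :\: nsupp h)) (ncoef l phi h)).
Proof.
move=> suppL; rewrite hypergeometric_annihilates.
split=> -[annE annT]; split.
- move=> g i Lg; apply: (ncoef_dact_eq0 (Ader R A i) phi Lg).1.
  exact: (euler_dact i suppL).1 (annE i) g Lg.
- move=> g h Lg Lh; apply: (transit_ncoef phi Lg Lh).1.
  exact: (toric_transit suppL).1 annT g h Lg Lh.
- move=> i; apply: (euler_dact i suppL).2 => g Lg.
  exact: (ncoef_dact_eq0 (Ader R A i) phi Lg).2 (annE g i Lg).
- apply: (toric_transit suppL).2 => g h Lg Lh.
  exact: (transit_ncoef phi Lg Lh).2 (annT g h Lg Lh).
Qed.

End NormalizedCoefficients.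

(** * Directed solutions *)

Section DirectedSolutions.
Variables (R : realType) (d n : nat) (A : 'M[int]_(d, n)) (beta : 'cV[R[i]]_d).
Variables (w : 'cV[R]_n) (Lam : set 'cV[R[i]]_n) (l : 'cV[R[i]]_n).
Local Notation C := R[i].
Local Notation T := {mpoly C[n]}.
Implicit Types (g h : 'cV[C]_n) (phi : logseries C n) (c : {set 'I_n} -> T).
Hypothesis latLam : exponent_lattices A beta Lam.
Hypothesis Ll : Lam l.

Lemma is_wmin_uniq (X : set 'cV[C]_n) g h : L_generic A w -> X `<=` Lam ->
  is_wmin w X g -> is_wmin w X h -> g = h.
Proof.
move=> gen XL [Xg ming] [Xh minh].
have [u uL gh] := lattice_sub latLam (XL _ Xg) (XL _ Xh).
have [u0|u0] := eqVneq u 0.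
  apply/eqP; rewrite -subr_eq0 gh u0; apply/eqP/matrixP => i k.
  by rewrite !mxE.
have := gen u uL u0; rewrite -gh wdotD wdotN subr_eq0 eq_le.
by move/wleE: (ming _ Xh) => ->; move/wleE: (minh _ Xg) => ->.
Qed.

Lemma wminP (X : set 'cV[C]_n) g : is_wmin w X g -> is_wmin w X (wmin w X).
Proof. by move=> mg; apply: (@xgetPex _ 0 (is_wmin w X)); exists g. Qed.

Lemma Bw_vminP I : Bw w Lam I -> is_wmin w (stratum Lam I) (vmin w Lam I).
Proof. by case/(stratum_has_wmin latLam) => g /wminP. Qed.

Lemma Aw_Bw I : Aw w Lam I -> Bw w Lam I.
Proof. by move=> [NI AI]; exact: AI. Qed.

Lemma logsupp_strata phi c : Flog_on Lam phi -> ncoef_family l Lam phi c ->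
  logsupp phi = \bigcup_(I in Act Lam c) stratum Lam I.
Proof.
move=> [_ suppL] phic; apply/seteqP; split=> [g gphi|g [I [NI cI] [Lg gI]]].
  have Lg := suppL _ gphi; exists (nsupp g) => //; split; first by exists g.
  apply: contraNneq (gphi : phi g != 0) => cg0; apply/eqP.
  by apply/(ncoef_eq0 latLam Ll _ Lg); rewrite phic.
apply: contraNneq cI => phig0; rewrite -gI -phic //.
by apply/eqP/(ncoef_eq0 latLam Ll _ Lg).
Qed.

(** A nonzero coefficient on [I] forces a nonzero one on every smaller [J],
    because then the gluing condition reads [c I = d^(I \ J) c J]. A minimum of
    the support thus bounds from below all strata [J] contained in [I]. *)
Lemma Act_sub_Aw phi c g0 : Flog_on Lam phi -> ncoef_family l Lam phi c ->
  (forall I J, NS Lam I -> NS Lam J ->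
     dact (derset R (J :\: I)) (c I) = dact (derset R (I :\: J)) (c J)) ->
  is_wmin w (logsupp phi) g0 -> Act Lam c `<=` Aw w Lam.
Proof.
move=> phiL phic glue [g0phi ming0] I [NI cI]; split=> // J NJ JI; split=> //.
exists g0; first by case: phiL => _; apply.
exists 0 => _ [g Jg <-]; apply: ming0.
rewrite (logsupp_strata phiL phic); exists J => //; split=> //.
apply: contraNneq cI => cJ0; have := glue I J NI NJ.
have /eqP -> : J :\: I == finset.set0 by rewrite finset.setD_eq0.
by rewrite /derset big_set0 dact1 cJ0 linear0 => ->.
Qed.

Lemma strata_has_wmin (Is : set {set 'I_n}) : Is !=set0 -> Is `<=` Bw w Lam ->
  exists2 I, Is I & is_wmin w (\bigcup_(J in Is) stratum Lam J) (vmin w Lam I).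
Proof.
move=> [I0 II0] IB; pose s := [seq I <- enum {set 'I_n} | `[< Is I >]].
have sP I : reflect (Is I) (I \in s).
  by rewrite mem_filter mem_enum andbT; exact: asboolP.
have I0s : I0 \in s by exact/sP.
have [I /sP II minI] := seq_minimum (fun I => wdot w (vmin w Lam I)) I0s.
exists I => //; split=> [|g [J IJ Jg]].
  by exists I => //; have [] := Bw_vminP (IB I II).
apply/wleE; apply: le_trans (minI J _) _; first exact/sP.
by apply/wleE; have [_] := Bw_vminP (IB J IJ); apply.
Qed.

Lemma sol_dirE phi : Flog_on Lam phi ->
  sol_dir A w Lam beta phi <->
  exists c, ncoef_family l Lam phi c /\ admissible_family A w Lam c.
Proof.
move=> phiL; have [_ suppL] := phiL; split=> [[_ ann minphi]|].
  have [/(_ _ _ _)annE annT] := (annihilated_ncoef latLam Ll suppL).1 ann.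
  pose c I := ncoef l phi (xget 0 (stratum Lam I)).
  have repr I : NS Lam I -> stratum Lam I (xget 0 (stratum Lam I)).
    by move=> [g Ig]; apply: (@xgetPex _ 0 (stratum Lam I)); exists g.
  have phic : ncoef_family l Lam phi c.
    move=> g Lg; have [Lr rI] := repr (nsupp g) (ex_intro _ g (conj Lg erefl)).
    have := annT g _ Lg Lr; rewrite rI finset.setDv /derset big_set0.
    by rewrite !dact1.
  have glue I J : NS Lam I -> NS Lam J ->
      dact (derset R (J :\: I)) (c I) = dact (derset R (I :\: J)) (c J).
    move=> [g [Lg <-]] [h [Lh <-]]; rewrite -(phic g Lg) -(phic h Lh).
    exact: annT.
  exists c; split=> //; split=> // [I i [g [Lg <-]]|I NI notA].
    by rewrite -phic //; exact: annE.
  apply/eqP/negPn/negP => cI; apply: notA.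
  have ActI : Act Lam c I by [].
  case: minphi => [phi0|[g0 ming0]]; last first.
    exact: (Act_sub_Aw phiL phic glue ming0).
  have [g Ig] := NI; have : logsupp phi g.
    by rewrite (logsupp_strata phiL phic); exists I.
  by rewrite /logsupp /= phi0 eqxx.
move=> [c [phic [annE glue notA]]]; split=> //.
  apply/(annihilated_ncoef latLam Ll suppL); split=> [g i Lg|g h Lg Lh].
    by rewrite phic //; apply: annE; exists g.
  by rewrite !phic //; apply: glue; [exists g | exists h].
have [[I ActI]|noAct] := pselect (Act Lam c !=set0).
  right; have [|J _ minJ] := @strata_has_wmin (Act Lam c) (ex_intro _ I ActI).
    move=> J [NJ cJ]; apply: Aw_Bw; apply: contrapT => /(notA J NJ) cJ0.
    by rewrite cJ0 eqxx in cJ.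
  by exists (vmin w Lam J); rewrite (logsupp_strata phiL phic).
left; apply/funext => g; apply/eqP/negPn/negP => gphi.
have : logsupp phi g by [].
by rewrite (logsupp_strata phiL phic) => -[J ActJ _]; apply: noAct; exists J.
Qed.

End DirectedSolutions.

Theorem theorem3p4 (R : realType) (d n : nat) (A : 'M[int]_(d, n))
    (beta : 'cV[R[i]]_d) (w : 'cV[R]_n) (Lam : set 'cV[R[i]]_n)
    (l : 'cV[R[i]]_n) (phi : logseries R[i] n) :
  \rank (map_mx intr A : 'M[rat]_(d, n)) = d ->
  L_generic A w ->
  exponent_lattices A beta Lam ->
  Lam l ->
  Flog_on Lam phi ->
  (sol_dir A w Lam beta phi <->
   exists c : {set 'I_n} -> {mpoly R[i][n]},
     ncoef_family l Lam phi c /\ admissible_family A w Lam c) /\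
  (forall c : {set 'I_n} -> {mpoly R[i][n]},
     ncoef_family l Lam phi c -> admissible_family A w Lam c ->
     (forall g, Lam g ->
        phi g = dact_inv (ntransit l g) (dact (ntransit g l) (c (nsupp g)))) /\
     (forall psi, Flog_on Lam psi -> ncoef_family l Lam psi c -> psi = phi) /\
     logsupp phi = \bigcup_(I in Act Lam c) stratum Lam I /\
     trivIset (Act Lam c) (stratum Lam) /\
     Act Lam c `<=` Aw w Lam /\
     (phi <> 0 ->
        is_wmin w [set vmin w Lam I | I in Act Lam c] (lexp w phi))).
Proof.
move=> _ gen latLam Ll phiL; split; first exact: sol_dirE.
move=> c phic adm; have [_ _ notA] := adm.
have suppE := logsupp_strata latLam Ll phiL phic.
have ActA : Act Lam c `<=` Aw w Lam.
  move=> I [NI cI]; apply: contrapT => /(notA I NI) cI0.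
  by rewrite cI0 eqxx in cI.
split; [|split; [|split; [|split; [|split]]]] => //.
- by move=> g Lg; rewrite -phic //; exact: (coef_recover latLam Ll).
- move=> psi [_ psiL] psic; apply/funext => g.
  have [Lg|Lg] := pselect (Lam g).
    rewrite (coef_recover latLam Ll psi Lg) (coef_recover latLam Ll phi Lg).
    by rewrite (psic g Lg) (phic g Lg).
  have off (chi : logseries R[i] n) : logsupp chi `<=` Lam -> chi g = 0.
    by move=> chiL; apply/eqP/negPn/negP => /chiL.
  by rewrite !off //; case: phiL.
- by move=> I J _ _ [g [[_ <-] [_ <-]]].
- move=> phi0; have [I0 ActI0] : Act Lam c !=set0.
    apply: contrapT => noAct; apply: phi0; apply/funext => g.
    apply/eqP/negPn/negP => gphi; have : logsupp phi g by [].
    by rewrite suppE => -[I ActI _]; apply: noAct; exists I.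
  have ActB : Act Lam c `<=` Bw w Lam by move=> I /ActA /Aw_Bw.
  have [I ActI minI] := strata_has_wmin latLam (ex_intro _ I0 ActI0) ActB.
  have lexpE : lexp w phi = vmin w Lam I.
    apply: (is_wmin_uniq latLam gen (X := logsupp phi)); first by case: phiL.
      by apply: (@wminP _ _ _ _ (vmin w Lam I)); rewrite suppE.
    by rewrite suppE.
  rewrite lexpE; split; first by exists I.
  move=> _ [J ActJ <-]; apply: minI.2; exists J => //.
  by have [] := Bw_vminP latLam (ActB J ActJ).
Qed.
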